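(* Let $R$ be a connected commutative ring, and let $f\in R[X]$ be separable over $R$. Then $f\neq 0$ and $\#\{r\in R: f(r)=0\}\le\deg(f)$.
   Context: Commutative rings have an identity element $1$ (which equals $0$ if and only if the ring is the zero ring). A commutative ring $R$ is connected if $\#\{x\in R: x^2=x\}=2$; equivalently, $R\neq\{0\}$ and its only idempotents are $0$ and $1$. A polynomial $f\in R[X]$ is separable (over $R$) if $f$ and its formal derivative $f'$ generate the unit ideal in $R[X]$, i.e. $R[X]f+R[X]f'=R[X]$. The polynomial $f$ is not assumed monic. *)

(* Defs.v *)
From mathcomp Require Import all_boot all_algebra.
From mathcomp Require Import classical_sets functions cardinality.

Set Implicit Arguments.
Unset Strict Implicit.
Unset Printing Implicit Defensive.

Import GRing.Theory.
Local Open Scope classical_set_scope.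
Local Open Scope card_scope.
Local Open Scope ring_scope.

(* Stated for possibly zero rings: the zero ring has a single idempotent, so
   it is not connected. *)
Definition connected_ring (R : comPzRingType) : Prop :=
  [set x : R | x ^+ 2 = x] #= `I_2.

(* [separable_poly] of mathcomp.field.separable is the coprimality of [f] and
   [f^`()] for the pseudo-gcd, over an integral domain; over a general
   commutative ring we ask that the ideal R[X]f + R[X]f' be all of R[X]. *)
Definition separable_over (R : comNzRingType) (f : {poly R}) : Prop :=
  [set u * f + v * f^`() | u in [set: {poly R}] & v in [set: {poly R}]]
    = [set: {poly R}].

(* Main.v *)
Require Import Defs.
From mathcomp Require Import all_boot all_algebra.
From mathcomp Require Import classical_sets functions cardinality.
From mathcomp Require Import boolp finmap ring.

(** Two roots r, s of a separable f are either equal or differ by a regular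
    element.  Write f = g (X - r).  Evaluating the derivative and the Bezout
    relation at r shows that g(r) = f'(r) is invertible, and d = s - r
    satisfies g(s) d = f(s) = 0 with g(s) congruent to g(r) modulo d, so
    d = w d^2 for some w ([separable_root_sub]).  Then w d is idempotent, hence
    0 or 1 because R is connected: in the first case d = w d * d = 0, in the
    second d is invertible ([connected_regular]).

    For pairwise distinct roots, these regular differences replace the absence
    of zero divisors in the classical argument: dividing f by X - r keeps all
    the other roots, so a nonzero polynomial has at most deg f of them
    ([size_roots_lt]).  Finally f is nonzero since the ideal generated by 0 and
    its derivative is zero, while 1 <> 0 in R[X]. *)

Import GRing.Theory.

Local Open Scope classical_set_scope.
Local Open Scope card_scope.
Local Open Scope ring_scope.

(** Reduces both the hypothesis on idempotents and the bound on roots to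
    statements on duplicate-free sequences, with no finiteness assumption. *)
Lemma card_le_IIP (T : choiceType) (A : set T) (n : nat) :
  A #<= `I_n <->
  (forall s : seq T, uniq s -> (forall x, x \in s -> A x) -> (size s <= n)%N).
Proof.
split=> [leAn s s_uniq sA | le_size].
  have Afin : finite_set A by apply/finite_set_leP; exists n.
  apply: leq_trans (geq_card_fset_set leAn); apply: uniq_leq_size => // x sx.
  by rewrite in_fset_set // in_setE; apply: sA.
have [/finite_fsetP[B AE] | Ainf] := pselect (finite_set A); last first.
  have [B BA ltnB] := infinite_set_fset n.+1 Ainf.
  have := le_size (enum_fset B) (fset_uniq B) (fun x Bx => BA x Bx).
  by rewrite leqNgt ltnB.
have cardB : [set` B] #= `I_(size (enum_fset B)) by apply/card_eq_fsetP.
rewrite AE (card_le_eql cardB) card_le_II.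
by apply: le_size => [|x xB]; [exact: fset_uniq | rewrite AE].
Qed.

Lemma connected_idempotent (R : comNzRingType) (e : R) :
  connected_ring R -> e ^+ 2 = e -> e = 0 \/ e = 1.
Proof.
move=> /card_eqPle[/card_le_IIP le2 _] ee.
have [-> | e0] := eqVneq e 0; first by left.
have [-> | e1] := eqVneq e 1; first by right.
have idem3 x : x \in [:: e; 0; 1] -> x ^+ 2 = x.
  by rewrite !inE => /or3P[] /eqP->; rewrite ?expr0n ?expr1n.
have uniq3 : uniq [:: e; 0; 1].
  by rewrite /= !inE negb_or e0 e1 eq_sym oner_eq0.
by have := le2 _ uniq3 idem3.
Qed.

Lemma separable_overP (R : comNzRingType) (f : {poly R}) :
  separable_over f -> exists u v : {poly R}, u * f + v * f^`() = 1.
Proof.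
move=> f_sep; have : [set: {poly R}] 1 by [].
by rewrite -f_sep => -[u _ [v _ uv]]; exists u, v.
Qed.

Lemma separable_root_sub (R : comNzRingType) (f : {poly R}) (r s : R) :
  separable_over f -> f.[r] = 0 -> f.[s] = 0 ->
  exists w : R, s - r = w * (s - r) ^+ 2.
Proof.
move=> /separable_overP[u [v uv]] fr fs.
have /factor_theorem[g fE] : root f r by apply/eqP.
have gr_inv : v.[r] * g.[r] = 1.
  have := congr1 (horner^~ r) uv.
  by rewrite fE derivM derivXsubC !hornerE subrr !mulr0 ?add0r /= ?mulr0 ?add0r.
have /factor_theorem[h gE] : root (g - g.[r]%:P) r.
  by rewrite /root !hornerE subrr.
have gs : g.[s] = g.[r] + h.[s] * (s - r).
  by have /(congr1 (horner^~ s)) := gE; rewrite !hornerE => <-; ring.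
exists (- (v.[r] * h.[s])).
have gs0 : g.[s] * (s - r) = 0 by rewrite -fs fE !hornerE.
rewrite gs in gs0.
transitivity (v.[r] * g.[r] * (s - r)); first by rewrite gr_inv mul1r.
transitivity (v.[r] * ((g.[r] + h.[s] * (s - r)) * (s - r))
   - v.[r] * h.[s] * (s - r) ^+ 2); first by ring.
by rewrite gs0; ring.
Qed.

(** The hypothesis says that d generates an idempotent ideal, generated by the
    idempotent w d. *)
Lemma connected_regular (R : comNzRingType) (d w : R) :
  connected_ring R -> d = w * d ^+ 2 -> d != 0 -> GRing.rreg d.
Proof.
move=> R_conn dE d0.
have dwd : d = w * d * d by rewrite -mulrA -expr2.
have idem : (w * d) ^+ 2 = w * d.
  by rewrite exprMn expr2 -mulrA -dE.
have [wd0 | wd1] := connected_idempotent R (w * d) R_conn idem.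
  by move: d0; rewrite dwd wd0 mul0r eqxx.
by apply: (can_inj (g := *%R w)) => x /=; rewrite mulrCA wd1 mulr1.
Qed.

(** Induction on the roots: in p(s) = q(s) (s - r) = 0 the regular factor s - r
    cancels, so every other root s of p is a root of q. *)
Lemma size_roots_lt (R : comNzRingType) (p : {poly R}) (rs : seq R) :
  p != 0 -> uniq rs -> all (root p) rs ->
  {in rs &, forall x y, y != x -> GRing.rreg (y - x)} ->
  (size rs < size p)%N.
Proof.
elim: rs p => [|r rs IHrs] p p0 /=; first by rewrite size_poly_gt0.
move=> /andP[r_rs rs_uniq] /andP[/factor_theorem[q pE] p_rs] rs_reg.
have q0 : q != 0 by apply: contraNneq p0 => q0; rewrite pE q0 mul0r.
rewrite pE size_Mmonic ?monicXsubC // size_XsubC addn2 /= ltnS.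
apply: IHrs => // [|x y x_rs y_rs]; last first.
  by apply: rs_reg; rewrite inE ?x_rs ?y_rs orbT.
apply/allP => x x_rs; have xr : x != r by apply: contraNneq r_rs => <-.
have reg : GRing.rreg (x - r).
  by apply: rs_reg => //; rewrite inE ?eqxx ?x_rs ?orbT.
by have := allP p_rs x x_rs; rewrite /root pE !hornerE mulIr_eq0.
Qed.

Theorem theorem1p5 (R : comNzRingType) (f : {poly R})
    (R_connected : connected_ring R) (f_separable : separable_over f) :
  f != 0 /\ [set r : R | f.[r] = 0] #<= `I_(size f).-1.
Proof.
have f0 : f != 0.
  have [u [v uv]] := separable_overP R f f_separable.
  apply/eqP => f0; move: uv; rewrite f0 deriv0 !mulr0 addr0 => /esym/eqP.
  by rewrite oner_eq0.
split=> //; apply/card_le_IIP => rs rs_uniq rs_roots.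
rewrite -ltnS prednK ?size_poly_gt0 //.
apply: size_roots_lt => // [|x y /rs_roots fx /rs_roots fy yx].
  by apply/allP => x /rs_roots/eqP.
have [w dE] := separable_root_sub R f x y f_separable fx fy.
by apply: (connected_regular R (y - x) w) => //; rewrite subr_eq0.
Qed.
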